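(* Let $S\in\mathcal{S}^d_1$, $G\in\mathcal{M}(S)$, $j\in\{1,\dots,d\}$, and assume that $D:=\operatorname{int}\operatorname{dom}\psi_G\ne\emptyset$. For every $n\ge1$, there exist $y_n,z_n\in G$ such that $$y_n^j-z_n^j>0,\qquad S(y_n-z_n,y_n-z_n)=0,$$ and $$\overline{\Sigma}^j_0(P_G)\subset\bigcup_{n}\{x\in\mathbb{R}^d:\ S(x-z_n,y_n-z_n)=0\}.$$
   Context: $\mathcal{S}^d_1$ is the set of invertible symmetric real $d\times d$ matrices with exactly one positive eigenvalue (counted with multiplicity). For such $S$, $S(x,y)=\langle x,Sy\rangle$ for $x,y\in\mathbb{R}^d$. $\mathcal{M}(S)$ is the family of closed non-empty $S$-monotone sets $G\subset\mathbb{R}^d$, i.e. $S(x-y,x-y)\ge0$ for all $x,y\in G$. For such $G$, and $x\in\mathbb{R}^d$, $$\psi_G(x)=\sup_{y\in G}\Big(S(x,y)-\tfrac12S(y,y)\Big)\in\mathbb{R}\cup\{+\infty\},\qquad P_G(x)=\operatorname*{arg\,min}_{y\in G}S(x-y,x-y)$$ (the possibly empty set of minimizers), and $\operatorname{dom}\psi_G=\{x:\psi_G(x)<\infty\}$. $x^j$ denotes the $j$th coordinate of $x\in\mathbb{R}^d$. $\overline{\Sigma}^j_0(P_G)$ is the set of $x\in\mathbb{R}^d$ for which there exist $y_1,y_2\in P_G(x)$ with $y_1^j\ne y_2^j$ and $S(y_1-y_2,y_1-y_2)=0$.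
   Formalization: If G contains no pair y,z with y^j−z^j>0 and S(y−z,y−z)=0 (e.g. d=1, S=1, G={0}), no such y_n,z_n exist; the formal statement then claims only that the set Σ̄^j_0(P_G) is empty, and otherwise gives y_n,z_n for every n≥1. *)

(* Defs.v *)
From HB Require Import structures.
From mathcomp Require Import all_boot all_order all_algebra.
From mathcomp Require Import all_classical all_reals all_analysis.

Set Implicit Arguments.
Unset Strict Implicit.
Unset Printing Implicit Defensive.

Import Order.TTheory GRing.Theory Num.Theory.
Import numFieldNormedType.Exports.

Local Open Scope classical_set_scope.
Local Open Scope ring_scope.

(* Multiplicity is that of a root of the characteristic polynomial. *)
Definition sym_one_pos (R : realType) (d : nat) : set 'M[R]_d :=
  [set S : 'M[R]_d | [/\ S^T = S, S \in unitmx &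
    exists a : R, [/\ 0 < a, eigenvalue S a, mup a (char_poly S) = 1%N &
      forall b : R, 0 < b -> eigenvalue S b -> b = a]]].

Definition bilin (R : realType) (d : nat) (S : 'M[R]_d) (x y : 'cV[R]_d) : R :=
  (x^T *m (S *m y)) 0 0.

Definition monotone_sets (R : realType) (d : nat) (S : 'M[R]_d) :
    set (set 'cV[R]_d) :=
  [set G : set 'cV[R]_d | [/\ closed G, G !=set0 &
    forall x y : 'cV[R]_d, G x -> G y -> 0 <= bilin S (x - y) (x - y)]].

Definition psi (R : realType) (d : nat) (S : 'M[R]_d) (G : set 'cV[R]_d)
    (x : 'cV[R]_d) : \bar R :=
  ereal_sup [set (bilin S x y - 2^-1 * bilin S y y)%:E | y in G].

Definition dom_psi (R : realType) (d : nat) (S : 'M[R]_d)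
    (G : set 'cV[R]_d) : set 'cV[R]_d :=
  [set x | (psi S G x < +oo)%E].

Definition proj (R : realType) (d : nat) (S : 'M[R]_d) (G : set 'cV[R]_d)
    (x : 'cV[R]_d) : set 'cV[R]_d :=
  [set y : 'cV[R]_d | G y /\
    forall y' : 'cV[R]_d, G y' ->
      bilin S (x - y) (x - y) <= bilin S (x - y') (x - y')].

Definition Sigma0 (R : realType) (d : nat) (S : 'M[R]_d) (G : set 'cV[R]_d)
    (j : 'I_d) : set 'cV[R]_d :=
  [set x | exists y1 y2 : 'cV[R]_d, [/\ proj S G x y1, proj S G x y2,
    y1 j 0 <> y2 j 0 & bilin S (y1 - y2) (y1 - y2) = 0]].

Definition isotropic_pair (R : realType) (d : nat) (S : 'M[R]_d)
    (G : set 'cV[R]_d) (j : 'I_d) (y z : 'cV[R]_d) : Prop :=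
  [/\ G y, G z, 0 < y j 0 - z j 0 & bilin S (y - z) (y - z) = 0].

(* Main.v *)
(* Let v be an eigenvector of S for its positive eigenvalue and tau x = <v, x>.
   By the spectral theorem S is negative definite on the kernel of tau, so tau is
   injective on G and G is a chain ordered by tau.  If y, z in G have an
   isotropic difference, every point of G whose tau-value lies between tau z and
   tau y is on the segment [z, y].  Hence two isotropic pairs whose tau-intervals
   overlap span the same line and define the same hyperplane
   S(x - z, y - z) = 0, and it is enough to keep one pair per rational number
   lying in some tau-interval (and per sign of tau(y - z), which is not
   determined by the sign of y^j - z^j). *)
Require Import Defs.
From HB Require Import structures.
From mathcomp Require Import all_boot all_order all_algebra.
From mathcomp Require Import all_classical all_reals all_analysis.
From mathcomp Require Import sesquilinear spectral complex ring lra.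

Set Implicit Arguments.
Unset Strict Implicit.
Unset Printing Implicit Defensive.

Import Order.TTheory GRing.Theory Num.Theory.
Import numFieldNormedType.Exports.

Local Open Scope classical_set_scope.
Local Open Scope ring_scope.
Local Notation toC := (@real_complex_def _ (Phant _)).

(** * Diagonalization and signature of real symmetric matrices *)

Lemma char_poly_conj (F : fieldType) (n : nat) (P A : 'M[F]_n) :
  P \in unitmx -> char_poly (invmx P *m A *m P) = char_poly A.
Proof.
move=> Pu; rewrite /char_poly /char_poly_mx.
have -> : 'X%:M - map_mx polyC (invmx P *m A *m P) =
    map_mx polyC (invmx P) *m ('X%:M - map_mx polyC A) *m map_mx polyC P.
  rewrite !map_mxM mulmxBr mulmxBl; congr (_ - _).
  by rewrite -mulmxA -scalar_mxC mulmxA -map_mxM mulVmx// map_mx1 mul1mx.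
rewrite !det_mulmx mulrAC -det_mulmx -map_mxM mulVmx// map_mx1.
by rewrite det1 mul1r.
Qed.

Lemma char_poly_diag (F : comNzRingType) (n : nat) (l : 'rV[F]_n) :
  char_poly (diag_mx l) = \prod_i ('X - (l 0 i)%:P).
Proof.
rewrite char_poly_trig ?diag_mx_is_trig//.
by apply: eq_bigr => i _; rewrite mxE eqxx mulr1n.
Qed.

(** Seen over [R[i]], a real symmetric matrix is Hermitian, so it is unitarily diagonalizable with
    real spectrum. The equality of characteristic polynomials is checked over [R[i]] and descends by
    injectivity of the embedding. *)
Lemma symmetric_spectral (R : rcfType) (n : nat) (A : 'M[R]_n) :
  A^T = A -> exists (P : 'M[R[i]]_n) (l : 'rV[R]_n),
    [/\ P \is unitarymx,
      map_mx toC A = map_mx Num.conj P^T *m map_mx toC (diag_mx l) *m P &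
      char_poly A = \prod_i ('X - (l 0 i)%:P)].
Proof.
move=> AT; pose B : 'M[R[i]]_n := map_mx toC A.
have Breal : B \is a mxOver Num.real.
  by apply/mxOverP => i j; rewrite mxE complex_real.
have Bherm : B \is hermsymmx.
  apply: realsym_hermsym => //; apply/is_hermitianmxP.
  by rewrite expr0 scale1r map_mx_id // /B map_trmx AT.
have /orthomx_spectralP := hermitian_normalmx Bherm.
have /mxOverP lreal := hermitian_spectral_diag_real Bherm.
have Pu := spectral_unitarymx B.
pose l := map_mx (@complex.Re R) (spectral_diag B).
have -> : spectral_diag B = map_mx toC l.
  apply/rowP => i; rewrite !mxE; have := lreal 0 i.
  by case: (spectral_diag B 0 i) => x y /complex_realP[k [-> ->]].
rewrite -map_diag_mx -/B => BE.
exists (spectralmx B), l; split=> //.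
  by rewrite {1}BE (invmx_unitary Pu).
apply: (map_poly_inj (real_complex R)).
rewrite map_char_poly -/B BE char_poly_conj ?unitarymx_unit//.
by rewrite -map_char_poly char_poly_diag.
Qed.

Lemma conj_map_toC (R : rcfType) (m n : nat) (A : 'M[R]_(m, n)) :
  map_mx Num.conj (map_mx toC A) = map_mx toC A.
Proof. by apply/matrixP => i k; rewrite !mxE conj_Creal ?complex_real. Qed.

Lemma mup_prod_XsubC_gt1 (F : fieldType) (I : finType) (l : I -> F) (i k : I) :
  i != k -> l i = l k -> (1 < mup (l i) (\prod_m ('X - (l m)%:P)))%N.
Proof.
move=> ik lik; rewrite mup_geq; last first.
  by apply/prodf_neq0 => m _; rewrite polyXsubC_eq0.
rewrite (bigD1 i)//= (bigD1 k) 1?eq_sym//= -lik mulrA expr2.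
exact: dvdp_mulr.
Qed.

(** Take for [v] an eigenvector of the positive eigenvalue [a]. In the coordinates [u x] the form is
    the sum of the [l i * |u_i|^2]; orthogonality to [v] kills the only coordinate with positive
    weight. *)
Lemma sym_one_pos_negdef (R : realType) (d : nat) (S : 'M[R]_d) :
  sym_one_pos S -> exists v : 'cV[R]_d, forall x : 'cV[R]_d,
    (v^T *m x) 0 0 = 0 ->
    bilin S x x <= 0 /\ (bilin S x x = 0 -> x = 0).
Proof.
move=> [ST Su [a [a0 ea ma aU]]].
have [P [l [Pu SE cS]]] := symmetric_spectral ST.
have evl i : eigenvalue S (l 0 i).
  rewrite eigenvalue_root_char cS /root horner_prod (bigD1 i)//= hornerXsubC.
  by rewrite subrr mul0r.
have lneg i : l 0 i < 0 \/ l 0 i = a.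
  case: (ltrgt0P (l 0 i)) => li; [right|by left|].
    exact: aU.
  (* A zero eigenvalue would contradict the invertibility of [S]. *)
  have := evl i; rewrite li => /eigenvalueP[w wS w0].
  move: w0; rewrite -(mulmxK Su w) wS scale0r mul0mx eqxx//.
have lU i k : l 0 i = a -> l 0 k = a -> i = k.
  move=> li lk; apply/eqP/negP => /negP ik.
  have := mup_prod_XsubC_gt1 ik (etrans li (esym lk)).
  by rewrite -cS li ma.
have [v vS v0] := eigenvalueP ea.
exists v^T => x; rewrite trmxK => vx.
pose u y : 'cV[R[i]]_d := P *m map_mx toC y.
have PP : map_mx Num.conj P^T *m P = 1%:M.
  by rewrite -invmx_unitary// mulVmx// unitarymx_unit.
have uT y : map_mx Num.conj (u y)^T = map_mx toC y^T *m map_mx Num.conj P^T.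
  by rewrite /u trmx_mul map_mxM -[X in X^T]/(map_mx _ _) map_trmx conj_map_toC.
have uv : map_mx toC (diag_mx l) *m u v^T = toC a *: u v^T.
  have : map_mx toC S *m map_mx toC v^T = toC a *: map_mx toC v^T.
    by rewrite -map_mxM -{1}ST -trmx_mul vS linearZ /= map_mxZ.
  move=> /(congr1 (mulmx P)); rewrite SE -scalemxAr => <-.
  by rewrite /u !mulmxA (unitarymxP Pu) mul1mx.
have uvi i : l 0 i != a -> u v^T i 0 = 0.
  move=> lia; have /matrixP/(_ i 0) := uv.
  rewrite map_diag_mx mul_diag_mx !mxE => /eqP.
  rewrite -subr_eq0 -mulrBl mulf_eq0 -rmorphB /= => /orP[|/eqP//].
  by rewrite (fmorph_eq0 (real_complex R)) subr_eq0 (negPf lia).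
have u0 y : u y = 0 -> y = 0.
  move=> uy; apply: (map_mx_inj (f := real_complex R)).
  by rewrite map_mx0 -[LHS]mul1mx -PP -mulmxA -/(u y) uy mulmx0.
have dot : \sum_i (u v^T i 0)^* * u x i 0 = 0.
  transitivity (toC ((v *m x) 0 0)); last by rewrite vx.
  transitivity ((map_mx toC (v *m x)) 0 0); last by rewrite mxE.
  rewrite map_mxM -[map_mx toC v]mulmx1 -PP mulmxA -mulmxA.
  rewrite -[v in RHS]trmxK -uT mxE.
  by apply: eq_bigr => i _; rewrite !mxE.
(* Since [v] has no coordinate other than the [i]-th, the vanishing product [dot] is a single term,
   whose first factor is nonzero because [v != 0]. *)
have uxi i : l 0 i = a -> u x i 0 = 0.
  move=> li; have uvk k : k != i -> u v^T k 0 = 0.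
    by move=> ki; apply/uvi/eqP => lk; move: ki; rewrite (lU _ _ li lk) eqxx.
  move: dot; rewrite (bigD1 i)//= big1 ?addr0; last first.
    by move=> k ki; rewrite uvk// rmorph0 mul0r.
  move=> /eqP; rewrite mulf_eq0 conjC_eq0 => /orP[/eqP uvi0|/eqP//].
  case/eqP: v0; rewrite -[v]trmxK (_ : v^T = 0) ?trmx0//; apply: u0.
  apply/colP => k; rewrite [RHS]mxE.
  by have [->|ki] := eqVneq k i => //; exact: uvk.
have bE : toC (bilin S x x) = \sum_i toC (l 0 i) * `|u x i 0| ^+ 2.
  transitivity ((map_mx toC (x^T *m (S *m x))) 0 0); first by rewrite mxE.
  rewrite !map_mxM SE !mulmxA -uT -!mulmxA -/(u x) map_diag_mx mul_diag_mx.
  rewrite [LHS]mxE; apply: eq_bigr => i _.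
  by rewrite [(\matrix_(_, _) _) _ _]mxE !mxE normCKC mulrCA.
have tle i : 0 <= - (toC (l 0 i) * `|u x i 0| ^+ 2).
  have [li|/uxi->] := lneg i; last by rewrite normr0 expr0n mulr0 oppr0.
  by rewrite -mulNr mulr_ge0// ?exprn_ge0// oppr_ge0 lecE /= eqxx ltW.
split.
  rewrite -lecR bE -oppr_ge0 -sumrN; exact: sumr_ge0.
move=> b0; apply: u0; apply/colP => i; rewrite [RHS]mxE.
have [li|/uxi//] := lneg i.
move/eqP: bE; rewrite b0 eq_sym -oppr_eq0 -sumrN psumr_eq0// => /allP/(_ i).
rewrite mem_index_enum => /(_ isT); rewrite oppr_eq0 mulf_eq0.
rewrite (fmorph_eq0 (real_complex R)) (lt_eqF li) /= expf_eq0 /= normr_eq0.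
by move/eqP.
Qed.

(** * Isotropic differences in a monotone set *)

Section BilinearForm.
Variables (R : realType) (d : nat) (S : 'M[R]_d).
Implicit Types x y z p r : 'cV[R]_d.

Lemma bilinDl x y z : bilin S (x + y) z = bilin S x z + bilin S y z.
Proof. by rewrite /bilin linearD mulmxDl mxE. Qed.

Lemma bilinZl k x z : bilin S (k *: x) z = k * bilin S x z.
Proof. by rewrite /bilin linearZ -scalemxAl mxE. Qed.

Lemma bilinDr x y z : bilin S x (y + z) = bilin S x y + bilin S x z.
Proof. by rewrite /bilin !mulmxDr mxE. Qed.

Lemma bilinZr k x z : bilin S x (k *: z) = k * bilin S x z.
Proof. by rewrite /bilin -!scalemxAr mxE. Qed.

Lemma bilinNl x z : bilin S (- x) z = - bilin S x z.
Proof. by rewrite -scaleN1r bilinZl mulN1r. Qed.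

Lemma bilinNr x z : bilin S x (- z) = - bilin S x z.
Proof. by rewrite -scaleN1r bilinZr mulN1r. Qed.

Lemma bilinC x z : S^T = S -> bilin S x z = bilin S z x.
Proof.
move=> ST; rewrite /bilin -[LHS]trace_mx11 -mxtrace_tr trace_mx11.
by rewrite !trmx_mul trmxK ST mulmxA.
Qed.

Hypothesis ST : S^T = S.
Variable v : 'cV[R]_d.
Let tau x := (v^T *m x) 0 0.
Hypothesis negdef : forall x, tau x = 0 ->
  bilin S x x <= 0 /\ (bilin S x x = 0 -> x = 0).

Let tauD x y : tau (x + y) = tau x + tau y.
Proof. by rewrite /tau mulmxDr mxE. Qed.

Let tauZ k x : tau (k *: x) = k * tau x.
Proof. by rewrite /tau -scalemxAr mxE. Qed.

Let tauB x y : tau (x - y) = tau x - tau y.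
Proof. by rewrite -scaleN1r tauD tauZ mulN1r. Qed.

(* The combination of [x] and [y] killed by [tau] has nonpositive square, so
   [bilin S x y >= 0]; then nothing in the square of [x + y] can cancel. *)
Lemma null_sum_colinear x y : 0 < tau x -> 0 < tau y ->
  0 <= bilin S x x -> 0 <= bilin S y y -> bilin S (x + y) (x + y) = 0 ->
  tau y *: x = tau x *: y.
Proof.
move=> tx ty xx yy; rewrite !bilinDl !bilinDr (bilinC y x ST) => xy0.
pose w := tau y *: x - tau x *: y.
have [|] := negdef (x := w); first by rewrite tauB !tauZ mulrC subrr.
have -> : bilin S w w = tau y ^+ 2 * bilin S x x + tau x ^+ 2 * bilin S y y
    - 2 * (tau x * tau y) * bilin S x y.
  rewrite /w !bilinDl !bilinDr !bilinNl !bilinNr !bilinZl !bilinZr.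
  by rewrite (bilinC y x ST); ring.
have txy := mulr_gt0 tx ty.
have xx2 := mulr_ge0 (exprn_ge0 2 (ltW ty)) xx.
have yy2 := mulr_ge0 (exprn_ge0 2 (ltW tx)) yy.
move=> wle w0; have xy : 0 <= bilin S x y by rewrite -(pmulr_rge0 _ txy); lra.
have -> : tau y *: x = w + tau x *: y by rewrite subrK.
rewrite w0 ?add0r//.
have -> : bilin S x x = 0 by lra.
have -> : bilin S y y = 0 by lra.
have -> : bilin S x y = 0 by lra.
by rewrite !mulr0 addr0 subr0.
Qed.

Variable G : set 'cV[R]_d.
Hypothesis monoG : forall x y, G x -> G y -> 0 <= bilin S (x - y) (x - y).

Lemma monotone_tau_inj x y : G x -> G y -> tau x = tau y -> x = y.
Proof.
move=> Gx Gy txy; apply/subr0_eq.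
have [|le0 eq0] := negdef (x := x - y); first by rewrite tauB txy subrr.
by apply: eq0; apply/le_anti/andP; split=> //; exact: monoG.
Qed.

(** If [p] is strictly between, [y - z] is the sum of [p - z] and [y - p], both of nonnegative
    square and positive [tau], so these are collinear. At the ends, [tau] is injective on [G]. *)
Lemma null_segment y z p : G y -> G z -> G p ->
  bilin S (y - z) (y - z) = 0 -> tau z <= tau p <= tau y ->
  exists k, p - z = k *: (y - z).
Proof.
move=> Gy Gz Gp yz0 /andP[]; rewrite le_eqVlt => /predU1P[zp _|zp].
  by exists 0; rewrite (monotone_tau_inj Gz Gp zp) subrr scale0r.
rewrite le_eqVlt => /predU1P[py|py].
  by exists 1; rewrite (monotone_tau_inj Gp Gy py) scale1r.
have pz : 0 < tau (p - z) by rewrite tauB subr_gt0.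
have yp : 0 < tau (y - p) by rewrite tauB subr_gt0.
have E : y - z = (p - z) + (y - p) by rewrite [RHS]addrC addrA subrK.
have /null_sum_colinear : bilin S (p - z + (y - p)) (p - z + (y - p)) = 0.
  by rewrite -E.
move=> /(_ pz yp (monoG Gp Gz) (monoG Gy Gp)) C.
have t0 : tau (p - z) + tau (y - p) != 0 by rewrite gt_eqF// addr_gt0.
(* The denominator is [tau (y - z)]. *)
exists (tau (p - z) / (tau (p - z) + tau (y - p))).
by rewrite mulrC -scalerA E scalerDr -C -scalerDl scalerA mulVf// scale1r.
Qed.

(** Here [r - p] is a nonzero multiple of [y - z], and moving the base point from [z] to [p] along
    this isotropic direction does not change the pairing with it. *)
Lemma null_segment_hyperplane y z p r : G y -> G z -> G p -> G r ->
  bilin S (y - z) (y - z) = 0 -> tau z <= tau p -> tau p < tau r ->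
  tau r <= tau y ->
  forall x, (bilin S (x - p) (r - p) == 0) = (bilin S (x - z) (y - z) == 0).
Proof.
move=> Gy Gz Gp Gr yz0 zp pr ry x.
have [k pE] : exists k, p - z = k *: (y - z).
  by apply: null_segment => //; rewrite zp (le_trans (ltW pr)).
have [m rE] : exists m, r - z = m *: (y - z).
  by apply: null_segment => //; rewrite ry (le_trans zp (ltW pr)).
have rpE : r - p = (m - k) *: (y - z).
  by rewrite scalerBl -pE -rE opprB addrA subrK.
have mk : m - k != 0.
  apply: contraTneq pr => mk; rewrite -subr_gt0 -tauB rpE mk scale0r.
  by rewrite -(scale0r 0) tauZ mul0r ltxx.
have -> : x - p = (x - z) - k *: (y - z) by rewrite -pE opprB addrA subrK.
rewrite rpE bilinZr mulf_eq0 (negPf mk) /= bilinDl bilinNl bilinZl yz0.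
by rewrite mulr0 subr0.
Qed.

(** Both pairs are compared with one pair [(p, r)]: the higher of the two lower ends and the lower
    of the two upper ends, kept distinct by [q]. *)
Lemma overlapping_null_hyperplane y z y' z' (q : R) :
  G y -> G z -> G y' -> G z' ->
  bilin S (y - z) (y - z) = 0 -> bilin S (y' - z') (y' - z') = 0 ->
  tau z < q < tau y -> tau z' < q < tau y' ->
  forall x, (bilin S (x - z) (y - z) == 0) = (bilin S (x - z') (y' - z') == 0).
Proof.
move=> Gy Gz Gy' Gz' yz0 yz0' /andP[zq qy] /andP[zq' qy'] x.
have [p [Gp zp zp' pq]] :
    exists p, [/\ G p, tau z <= tau p, tau z' <= tau p & tau p < q].
  by case: (leP (tau z) (tau z')) => [?|/ltW ?]; [exists z'|exists z].
have [r [Gr ry ry' qr]] :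
    exists r, [/\ G r, tau r <= tau y, tau r <= tau y' & q < tau r].
  by case: (leP (tau y) (tau y')) => [?|/ltW ?]; [exists y|exists y'].
have pr := lt_trans pq qr.
rewrite -(null_segment_hyperplane Gy Gz Gp Gr)//.
by rewrite -(null_segment_hyperplane Gy' Gz' Gp Gr).
Qed.

End BilinearForm.

(** * Countable selection of pairs *)

(** Two minimizers give [x] the same value; expanding the difference around [y2], the isotropic
    square drops out and only the cross term remains. *)
Lemma Sigma0_isotropic_pair (R : realType) (d : nat) (S : 'M[R]_d)
    (G : set 'cV[R]_d) (j : 'I_d) (x : 'cV[R]_d) :
  S^T = S -> Sigma0 S G j x ->
  exists y z, isotropic_pair S G j y z /\ bilin S (x - z) (y - z) = 0.
Proof.
move=> ST [y1 [y2 [P1 P2 ne yy0]]].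
wlog lt12 : y1 y2 P1 P2 ne yy0 / y2 j 0 < y1 j 0.
  move=> W; case: (ltgtP (y1 j 0) (y2 j 0)) => // y12; last exact: W y12.
  apply: W y12 => //; first exact: nesym.
  by rewrite -opprB bilinNl bilinNr opprK.
have [[G1 m1] [G2 m2]] := (P1, P2).
exists y1, y2; split; first by split; rewrite ?subr_gt0.
have E : bilin S (x - y1) (x - y1) = bilin S (x - y2) (x - y2).
  by apply/le_anti; rewrite m1// m2.
move: E; have -> : x - y1 = (x - y2) - (y1 - y2) by rewrite opprB addrA subrK.
move: (x - y2) (y1 - y2) yy0 => u w yy0.
rewrite !bilinDl !bilinDr !bilinNl !bilinNr yy0 (bilinC w u ST) => E.
lra.
Qed.

(* If G has no isotropic_pair at all (for example, if G is a singleton), no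
   sequence (y_n, z_n) exists and N is empty; in every other case
   N is the set of all n >= 1. *)
Theorem theorem4p8 (R : realType) (d : nat) (S : 'M[R]_d) (G : set 'cV[R]_d)
    (j : 'I_d) (hS : sym_one_pos S) (hG : monotone_sets S G)
    (hD : interior (dom_psi S G) !=set0) :
  exists (N : set nat) (y z : nat -> 'cV[R]_d),
    [/\ (exists y0 z0 : 'cV[R]_d, isotropic_pair S G j y0 z0) ->
          N = [set n | (1 <= n)%N],
        forall n, N n -> isotropic_pair S G j (y n) (z n) &
        Sigma0 S G j `<=`
          \bigcup_(n in N) [set x : 'cV[R]_d | bilin S (x - z n) (y n - z n) = 0]].
Proof.
have [ST _ _] := hS; have [_ _ monoG] := hG.
have [v negdef] := sym_one_pos_negdef hS.
have [[y0 [z0 yz0]]|noP] := pselect (exists y0 z0, isotropic_pair S G j y0 z0);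
    last first.
  exists set0, (fun=> 0), (fun=> 0); split=> // x.
  move=> /(Sigma0_isotropic_pair ST)[y [z [yz _]]].
  by case: noP; exists y, z.
(* The sign is chosen later so that the functional increases from [z] to [y]; it does not affect the
   kernel. *)
pose w (b : bool) : 'cV[R]_d := (-1) ^+ b *: v.
have wE b (x : 'cV[R]_d) : ((w b)^T *m x) 0 0 = (-1) ^+ b * (v^T *m x) 0 0.
  by rewrite /w linearZ -scalemxAl mxE.
have negdefw b (x : 'cV[R]_d) : ((w b)^T *m x) 0 0 = 0 ->
    bilin S x x <= 0 /\ (bilin S x x = 0 -> x = 0).
  by rewrite wE => /eqP; rewrite mulf_eq0 signr_eq0 => /eqP/negdef.
pose good (i : bool * rat) (p : 'cV[R]_d * 'cV[R]_d) :=
  isotropic_pair S G j p.1 p.2 /\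
  ((w i.1)^T *m p.2) 0 0 < ratr i.2 < ((w i.1)^T *m p.1) 0 0.
(* Codes are shifted by one because the numbering starts at 1. An index without a good pair receives
   the default [(y0, z0)]. *)
have /boolp.choice[f fP] : forall n, exists p : 'cV[R]_d * 'cV[R]_d,
    isotropic_pair S G j p.1 p.2 /\
    forall i, n = (pickle i).+1 -> (exists p', good i p') -> good i p.
  move=> n.
  have [[i [nE [p gp]]]|no] := pselect (exists i : bool * rat,
      n = (pickle i).+1 /\ exists p, good i p).
    exists p; split; first by case: gp.
    move=> k kE _; have -> // : k = i.
    by apply: (pcan_inj pickleK); apply: succn_inj; rewrite -kE.
  by exists (y0, z0); split=> // i nE ex; case: no; exists i.
exists [set n | (1 <= n)%N], (fun n => (f n).1), (fun n => (f n).2).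
split=> // [n _|x /(Sigma0_isotropic_pair ST)[y [z [yz xyz]]]].
  by have [] := fP n.
have [Gy Gz jyz yy0] := yz.
(* Otherwise negative definiteness gives [y = z], against the strict inequality of the [j]-th
   coordinates. *)
have t0 : (v^T *m (y - z)) 0 0 != 0.
  apply/eqP => /negdef[_ /(_ yy0) /colP/(_ j)].
  by rewrite !mxE => yzj; rewrite yzj ltxx in jyz.
pose b := (v^T *m (y - z)) 0 0 < 0.
have : ((w b)^T *m z) 0 0 < ((w b)^T *m y) 0 0.
  have E : ((w b)^T *m y) 0 0 - ((w b)^T *m z) 0 0 = `|(v^T *m (y - z)) 0 0|.
    by rewrite normrEsign -/b -wE mulmxBr [RHS]mxE [X in _ = _ + X]mxE.
  by rewrite -subr_gt0 E normr_gt0.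
move=> /rat_in_itvoo[q]; rewrite in_itv /= => zqy.
(* The pair [(y, z)] itself shows that the index [(b, q)] has a good pair, so the chosen one is good
   and overlaps it at [q]. *)
have [[Gf1 Gf2 _ f0] fq] : good (b, q) (f (pickle (b, q)).+1).
  by have [_] := fP (pickle (b, q)).+1; apply=> //; exists (y, z).
exists (pickle (b, q)).+1 => //=; apply/eqP.
have <- := overlapping_null_hyperplane ST (negdefw b) monoG
  Gy Gz Gf1 Gf2 yy0 f0 zqy fq.
by rewrite xyz.
Qed.
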